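(* Let $(T_n^1,T_n^2)_{n\ge0}$ be a sequence of pairs of UA trees with any joint distribution, and denote their vertex-labeled centrality sets by $(A_r^1(n),A_r^2(n))$, $r\in\mathbb N$; that is, $A_r^i(n)$ is the set of labels of the $r$ most central vertices of $T_n^i$. Then there exists a constant $C<\infty$ such that for all $K$ and for all large enough $n\ge n_0(K)$, $$\mathbb P\left(\left|A_K^1(n)\cap A_K^2(n)\right|\ge 0.2\,K\right)\ge 1-\frac{C\log(K)}{K}.$$
   Context: Uniform attachment (UA) tree sequence: $T_0$ is a single node labeled $0$; given $T_{n-1}$ on nodes $\{0,\dots,n-1\}$, $T_n$ is obtained by adding a node labeled $n$ together with an edge connecting it to a node of $\{0,\dots,n-1\}$ chosen uniformly at random. In the claim, $(T_n^1)_{n\ge0}$ and $(T_n^2)_{n\ge0}$ are each marginally UA tree sequences. Vertices are identified with their arrival-time labels in their respective tree, so the intersection is an intersection of sets of labels. Centrality: for a vertex $v$ of a tree $T$, $\psi_T(v)$ is the size (number of vertices) of the maximal component after removing all edges connected to $v$. The $r$ most central vertices of $T$ are the $r$ vertices with the smallest values of $\psi_T$, with ties broken uniformly at random.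
   Formalization: ''For all K'' is taken as all K ≥ 2: at K = 1 the bound has log(1) = 0 and would force the two most central vertices to coincide almost surely, which fails for independent UA trees; at K = 0 the quantity log(K)/K is undefined. *)

(* Defs.v *)
From HB Require Import structures.
From mathcomp Require Import all_boot all_order all_algebra all_fingroup.
From mathcomp Require Import all_classical all_reals all_analysis.
Set Implicit Arguments.
Unset Strict Implicit.
Unset Printing Implicit Defensive.
Import Order.TTheory GRing.Theory Num.Theory.

(* A graph on the labels {0, ..., n-1} is its edge set; an undirected edge
   between x and y is stored as both ordered pairs (x, y) and (y, x). *)
Definition graph (n : nat) : Type := {set 'I_n * 'I_n}.

Definition old_vertex (n : nat) (x : 'I_n) : 'I_n.+1 := widen_ord (leqnSn n) x.

(* The new vertex has label n, which is ord_max in 'I_n.+1. *)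
Definition attach (n : nat) (t : graph n) (k : 'I_n) : graph n.+1 :=
  ([set (old_vertex e.1, old_vertex e.2) | e in t]
   :|: [set (old_vertex k, ord_max); (ord_max, old_vertex k)])%SET.

Definition remove_edges_at (n : nat) (t : graph n) (v : 'I_n) : rel 'I_n :=
  [rel x y | [&& (x, y) \in t, x != v & y != v]].

Definition component (n : nat) (e : rel 'I_n) (x : 'I_n) : {set 'I_n} :=
  [set y | connect e x y]%SET.

(* The vertex v itself remains, as an isolated component of size 1. *)
Definition psi (n : nat) (t : graph n) (v : 'I_n) : nat :=
  \max_(x < n) #|component (remove_edges_at t v) x|.

(* Vertices are ranked by psi, and ties are resolved by the permutation s. *)
Definition more_central (n : nat) (t : graph n) (s : {perm 'I_n}) (u v : 'I_n)
    : bool :=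
  ((psi t u < psi t v) || ((psi t u == psi t v) && (s u < s v)))%N.

Definition most_central (n : nat) (t : graph n) (s : {perm 'I_n}) (r : nat)
    : {set 'I_n} :=
  [set v | (#|[set u | more_central t s u v]%SET| < r)%N]%SET.

Local Open Scope classical_set_scope.
Local Open Scope ring_scope.
Local Open Scope ereal_scope.

(* The last clause says that, conditionally on the tree T n (which has n+1
   vertices), the neighbour of the vertex n+1 is uniform.  As a labelled tree
   almost surely determines its own past, conditioning on T n is the same as
   conditioning on the whole history T 0, ..., T n. *)
Definition UA_tree_sequence (R : realType) (d : measure_display)
    (Omega : measurableType d) (P : probability Omega R)
    (T : forall n : nat, Omega -> graph n.+1) : Prop :=
  [/\ forall (n : nat) (t : graph n.+1), measurable [set w | T n w = t],
      P [set w | T 0%N w = finset.set0] = 1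
    & forall (n : nat) (t : graph n.+1) (k : 'I_n.+1),
        P [set w | T n w = t /\ T n.+1 w = attach t k]
        = (n.+1%:R^-1)%:E * P [set w | T n w = t]].

(* For every n, the tie-breaking permutation is uniform conditionally on T n. *)
Definition uniform_tie_breaking (R : realType) (d : measure_display)
    (Omega : measurableType d) (P : probability Omega R)
    (T : forall n : nat, Omega -> graph n.+1)
    (s : forall n : nat, Omega -> {perm 'I_n.+1}) : Prop :=
  (forall (n : nat) (p : {perm 'I_n.+1}), measurable [set w | s n w = p]) /\
  (forall (n : nat) (t : graph n.+1) (p : {perm 'I_n.+1}),
     P [set w | T n w = t /\ s n w = p]
     = ((n.+1)`!%:R^-1)%:E * P [set w | T n w = t]).

Definition centrality_set (Omega : Type)
    (T : forall n : nat, Omega -> graph n.+1)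
    (s : forall n : nat, Omega -> {perm 'I_n.+1})
    (r n : nat) (w : Omega) : {set 'I_n.+1} :=
  most_central (T n w) (s n w) r.

(* Main.v *)
Require Import Defs.
From HB Require Import structures.
From mathcomp Require Import all_boot all_order all_algebra all_fingroup.
From mathcomp Require Import all_classical all_reals all_analysis.
From mathcomp Require Import ring lra zify.
Set Implicit Arguments.
Unset Strict Implicit.
Unset Printing Implicit Defensive.
Import Order.TTheory GRing.Theory Num.Theory.
Local Open Scope classical_set_scope.
Local Open Scope ring_scope.

(** Root every tree at vertex 0 and let [S v] be the size of the subtree of [v].
    If no vertex [v >= 1] has [S v > n - b], then [psi v <= n - b] holds
    exactly when [S v > b]; when at most [K] vertices satisfy this, they are all
    among the [K] most central ones, however ties are broken.

    Subtree sizes are Polya urns, so [P(S v > b) = 'C(n - b, v) / 'C(n, v)] and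
    the sums over [v] telescope.  For [b ~ 25 n / (24 K)] one finds on average
    about [0.96 K] vertices with [S v > b], of which at most [0.34 K] have a
    label [>= K].  In the second moments of these counts, pairs in no ancestral
    relation are negatively correlated, and ancestral pairs contribute
    [O(K log K)] because [u] is an ancestor of [v] with probability [1/(u+1)].
    By Chebyshev, outside an event of probability [O(log K / K)] the labels
    [< K] fill at least [0.6 K] of the [K] most central places in each tree, and
    two subsets of [{0, ..., K-1}] of that size share at least [0.2 K] labels.
*)

(** * Recursive trees coded by parents; ancestors and subtree sizes *)

(* [s : code n.+1] records the parent [s.1] of the vertex [n.+1] and the code
   [s.2] of the tree before its arrival; [desc s v w] says that [v] lies on the
   path from the root 0 to [w], endpoints included. *)
Fixpoint code (n : nat) : Type :=
  if n is n'.+1 then ('I_n'.+1 * code n')%type else unit.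

Fixpoint tree (n : nat) : code n -> graph n.+1 :=
  match n with
  | 0 => fun _ => finset.set0
  | n'.+1 => fun s => attach (tree s.2) s.1
  end.

Fixpoint desc (n : nat) : code n -> nat -> nat -> bool :=
  match n with
  | 0 => fun _ v w => (v == 0%N) && (w == 0%N)
  | n'.+1 => fun s v w =>
      if w == n'.+1 then (v == w) || desc s.2 v s.1 else desc s.2 v w
  end.

Definition subtree_size (n : nat) (s : code n) (v : nat) : nat :=
  (\sum_(w < n.+1) desc s v w)%N.

Lemma desc_leq n (s : code n) v w : desc s v w -> (v <= w <= n)%N.
Proof.
elim: n s v w => [|n IH] s v w /=; first by move=> /andP[/eqP-> /eqP->].
case: ifP => [/eqP -> /orP[/eqP->|/IH]|_ /IH]; first by rewrite !leqnn.
  by move=> /andP[H1 H2]; rewrite leqnn andbT (leq_trans H1)// ltnW// ltn_ord.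
by move=> /andP[-> H]; rewrite leqW.
Qed.

Lemma desc_refl n (s : code n) v : (v <= n)%N -> desc s v v.
Proof.
elim: n s => [|n IH] s /=; first by rewrite leqn0 => /eqP->.
by rewrite leq_eqVlt; case: eqP => [_ _|_ /= /IH//]; rewrite eqxx.
Qed.

(** The ancestors of [w] form a path, along which labels increase. *)
Lemma desc_chain n (s : code n) u v w :
  desc s u w -> desc s v w -> (u <= v)%N -> desc s u v.
Proof.
elim: n s u v w => [|n IH] s u v w /=.
  by move=> /andP[-> _] /andP[-> _].
case: (w =P n.+1) => [->|_].
  case/orP => [/eqP->|du].
    by case/orP => [/eqP->|/desc_leq]; [rewrite !eqxx|lia].
  case/orP => [/eqP->|dv]; first by rewrite eqxx du orbT.
  move=> uv; case: (v =P n.+1) => [v1|_]; last exact: IH du dv uv.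
  by have := desc_leq dv; have := ltn_ord s.1; lia.
move=> du dv uv; case: (v =P n.+1) => [v1|_]; last exact: IH du dv uv.
by have := desc_leq dv; lia.
Qed.

Lemma desc_new n (s : code n.+1) v : (v <= n)%N ->
  desc s v n.+1 = desc s.2 v s.1.
Proof. by move=> vn /=; rewrite eqxx; case: eqP => //; lia. Qed.

Lemma desc_old n (s : code n.+1) v w : (w <= n)%N -> desc s v w = desc s.2 v w.
Proof. by move=> wn /=; case: eqP => //; lia. Qed.

Arguments desc : simpl never.

Lemma subtree_size_old n (s : code n.+1) v : (v <= n)%N ->
  subtree_size s v = (subtree_size s.2 v + desc s.2 v s.1)%N.
Proof.
move=> vn; rewrite /subtree_size big_ord_recr /= desc_new//; congr (_ + _)%N.
by apply: eq_bigr => i _; rewrite desc_old // -ltnS.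
Qed.

Lemma subtree_size_last n (s : code n) : subtree_size s n = 1%N.
Proof.
rewrite /subtree_size big_ord_recr /= desc_refl// big1 ?add0n// => i _.
by apply/eqP; rewrite eqb0; apply/negP => /desc_leq; have := ltn_ord i; lia.
Qed.

Lemma desc0 n (s : code n) v : (v <= n)%N -> desc s 0 v.
Proof.
elim: n s v => [|n IH] s v; first by rewrite leqn0.
rewrite /desc -/desc; case: eqP => [-> _|/eqP ne vn];
  first by rewrite IH // -ltnS ltn_ord.
by apply: IH; rewrite -ltnS ltn_neqAle ne.
Qed.

Lemma subtree_size0 n (s : code n) : subtree_size s 0 = n.+1.
Proof.
rewrite /subtree_size (eq_bigr (fun=> 1%N)) ?sum1_card ?card_ord//.
by move=> i _; rewrite desc0 // -ltnS.
Qed.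

(** By [desc_chain], a common descendant would make [u] an ancestor of [v], so the two subtrees are
    disjoint. *)
Lemma subtree_size_disjoint n (s : code n) u v : (u <= v)%N -> ~~ desc s u v ->
  (subtree_size s u + subtree_size s v <= n.+1)%N.
Proof.
move=> uv nuv; rewrite /subtree_size -big_split /= -[X in (_ <= X)%N]card_ord.
rewrite -sum1_card; apply: leq_sum => i _.
case: (boolP (desc s u i)) => du; case: (boolP (desc s v i)) => dv //=.
by rewrite (desc_chain du dv uv) in nuv.
Qed.

(** * Expectation under uniform attachment *)

Section Mean.
Variable R : realType.

(** The last parent is averaged out first, given the earlier tree [s]. One-step recursions thus
    reduce to identities that hold for each [s]. *)
Fixpoint mean (n : nat) : (code n -> R) -> R :=
  match n with
  | 0 => fun f => f tt
  | n'.+1 => fun f =>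
      mean (fun s : code n' => n'.+1%:R^-1 * \sum_(k < n'.+1) f (k, s))
  end.

Lemma meanS n (f : code n.+1 -> R) :
  mean f = mean (fun s : code n => n.+1%:R^-1 * \sum_(k < n.+1) f (k, s)).
Proof. by []. Qed.

Lemma eq_mean n (f g : code n -> R) : f =1 g -> mean f = mean g.
Proof. by move=> /funext ->. Qed.

Lemma le_mean n (f g : code n -> R) : (forall s, f s <= g s) -> mean f <= mean g.
Proof.
elim: n f g => [|n IH] f g fg /=; first exact: fg.
by apply: IH => s; apply: ler_wpM2l; rewrite ?invr_ge0//; apply: ler_sum.
Qed.

Lemma meanD n (f g : code n -> R) :
  mean (fun s => f s + g s) = mean f + mean g.
Proof.
elim: n f g => [|n IH] f g //=; rewrite -IH; apply: eq_mean => s.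
by rewrite big_split mulrDr.
Qed.

Lemma meanZ n c (f : code n -> R) : mean (fun s => c * f s) = c * mean f.
Proof.
elim: n f => [|n IH] f //=; rewrite -IH; apply: eq_mean => s.
by rewrite -mulr_sumr mulrCA.
Qed.

Lemma mean_cst n c : @mean n (fun=> c) = c.
Proof.
elim: n => [|n IH] //=; rewrite -[RHS]IH; apply: eq_mean => s.
by rewrite sumr_const card_ord -[c *+ _]mulr_natl mulKf// pnatr_eq0.
Qed.

Lemma mean_sum n (I : Type) (r : seq I) (A : pred I) (f : I -> code n -> R) :
  mean (fun s => \sum_(i <- r | A i) f i s) = \sum_(i <- r | A i) mean (f i).
Proof.
elim: n f => [|n IH] f //=; rewrite -IH; apply: eq_mean => s.
by rewrite exchange_big /= mulr_sumr.
Qed.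

End Mean.

(** * The law of one subtree size *)

Section Moments.
Variable R : realType.

Lemma natr_ltn_addb (m b : nat) (d : bool) :
  (b < m + d)%N%:R = (b < m)%N%:R + (m == b)%:R * d%:R :> R.
Proof.
by case: d; rewrite ?addn0 ?addn1 ?mulr1 ?mulr0 ?addr0// ltnS;
  case: ltngtP; rewrite ?addr0 ?add0r.
Qed.

Lemma natr_eq_leq (m b : nat) :
  (m == b)%:R = (b <= m)%N%:R - (b < m)%N%:R :> R.
Proof. by case: ltngtP; rewrite ?subr0 ?subrr. Qed.

Lemma sum_desc n (s : code n) v :
  \sum_(k < n.+1) (desc s v k)%:R = (subtree_size s v)%:R :> R.
Proof. by rewrite -natr_sum. Qed.

Lemma natr_eq_mul (m b : nat) : (m == b)%:R * m%:R = (m == b)%:R * b%:R :> R.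
Proof. by case: eqP => [->|]; rewrite ?mul0r. Qed.

Lemma natrS_neq0 n : n.+1%:R != 0 :> R.
Proof. by rewrite pnatr_eq0. Qed.

(** The new vertex matters only when the size is exactly [b], and it then joins the subtree with
    probability [b / n.+1]. So the coefficients do not depend on the tree. *)
Lemma avg_subtree_size n (s : code n) v b : (v <= n)%N ->
  n.+1%:R^-1 * \sum_(k < n.+1) (b < subtree_size ((k, s) : code n.+1) v)%N%:R
  = (1 - b%:R / n.+1%:R) * (b < subtree_size s v)%N%:R
    + b%:R / n.+1%:R * (b <= subtree_size s v)%N%:R :> R.
Proof.
move=> vn; under eq_bigr do rewrite subtree_size_old//= natr_ltn_addb.
rewrite big_split /= -mulr_sumr sum_desc sumr_const card_ord natr_eq_mul.
rewrite natr_eq_leq -[(b < _)%N%:R *+ _]mulr_natl.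
by have := natrS_neq0 n; move: n.+1%:R => N N0; field.
Qed.

(** The threshold is inclusive: more than [b] vertices corresponds to [b.+1]. *)
Definition prob_size n v b : R := mean (fun s : code n => (b <= subtree_size s v)%N%:R).

Lemma prob_size_rec n v b : (v <= n)%N ->
  prob_size n.+1 v b.+1
  = (1 - b%:R / n.+1%:R) * prob_size n v b.+1 + b%:R / n.+1%:R * prob_size n v b.
Proof.
move=> vn; rewrite /prob_size meanS -!meanZ -meanD; apply: eq_mean => s.
exact: avg_subtree_size.
Qed.

Lemma prob_size_ge0 n v b : 0 <= prob_size n v b.
Proof. by rewrite -[X in X <= _](@mean_cst R n 0); apply: le_mean. Qed.

Lemma prob_size_le n v b : prob_size n v b.+1 <= prob_size n v b.
Proof.
apply: le_mean => s; rewrite ler_nat; case: (boolP (b.+1 <= _)%N) => // h.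
by rewrite (ltnW h).
Qed.

Lemma prob_size_refl v b : prob_size v v b.+1 = (b == 0%N)%:R.
Proof.
rewrite /prob_size (eq_mean (g := fun=> (b == 0%N)%:R)) ?mean_cst// => s.
by rewrite subtree_size_last ltnS leqn0.
Qed.

(* The probability that the subtree of [v] has more than [b] vertices, see
   [prob_sizeE]. *)
Definition polya_tail n v b : R := 'C(n - b, v)%:R / 'C(n, v)%:R.

Lemma polya_tail_ge0 n v b : 0 <= polya_tail n v b.
Proof. by rewrite divr_ge0. Qed.

Lemma natr_mul_bin_down n v :
  (n.+1%:R - v%:R) * 'C(n.+1, v)%:R = n.+1%:R * 'C(n, v)%:R :> R.
Proof.
have [vn|nv] := leqP v n.+1.
  by rewrite -natrB// -!natrM -mul_bin_down.
by rewrite !bin_small ?mulr0// ltnW.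
Qed.

Lemma natr_mul_bin_left n v :
  v.+1%:R * 'C(n, v.+1)%:R = (n%:R - v%:R) * 'C(n, v)%:R :> R.
Proof.
have [vn|nv] := leqP v n.
  by rewrite -natrB// -!natrM -mul_bin_left.
by rewrite !bin_small ?mulr0// ltnW.
Qed.

Lemma natr_bin_neq0 n v : (v <= n)%N -> 'C(n, v)%:R != 0 :> R.
Proof. by rewrite pnatr_eq0 -lt0n bin_gt0. Qed.

(* The recursion of a Polya urn started at time [v] with one ball of the
   tracked colour and [v] others. *)
Lemma polya_urn (F : nat -> nat -> R) c v : (0 < v)%N ->
  (forall b, F v b.+1 = c * (b == 0%N)%:R) ->
  (forall n b, (v <= n)%N -> F n.+1 b.+1
     = (1 - b%:R / n.+1%:R) * F n b.+1 + b%:R / n.+1%:R * F n b) ->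
  forall n b, (v <= n)%N -> F n b.+1 = c * polya_tail n v b.
Proof.
move=> v0 Fv FS; elim=> [|n IH] b vn; first by move: v0 vn; case: v {Fv FS}.
rewrite leq_eqVlt in vn; case/orP: vn => [/eqP vn|vn].
  rewrite -vn Fv /polya_tail; congr (_ * _).
  case: b => [|b] /=; first by rewrite subn0 divff// natr_bin_neq0.
  by rewrite bin_small ?mul0r//; lia.
rewrite ltnS in vn; rewrite FS// IH//.
have Cn := natr_bin_neq0 vn; have Cn1 := natr_bin_neq0 (leqW vn).
have N0 := natrS_neq0 n.
case: b => [|b].
  by rewrite /polya_tail !subn0 !divff// mul0r subr0 mul0r addr0 mul1r.
(* If [n <= b], both truncated differences are 0, and ['C(0, v) = 0] since [v > 0]. *)
rewrite IH// /polya_tail subSS; have [bn|nb] := leqP b.+1 n; last first.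
  have -> : (n - b.+1 = 0)%N by lia.
  have -> : (n - b = 0)%N by lia.
  by rewrite bin_small ?mul0r ?mulr0 ?addr0//; lia.
(* Absorption at [n] and at [n - b.+1] leaves an identity of rational functions. *)
have /= := natr_mul_bin_down n v; have := natr_mul_bin_down (n - b.+1) v.
rewrite (_ : (n - b.+1).+1 = n - b)%N; last lia.
have -> : (n - b)%:R = n.+1%:R - b.+1%:R :> R by rewrite -natrB//; lia.
have V0 : n.+1%:R - v%:R != 0 :> R.
  by rewrite -natrB ?leqW// pnatr_eq0 subn_eq0 -ltnNge ltnS.
move: Cn Cn1 N0 V0.
move: 'C(n, v)%:R 'C(n.+1, v)%:R 'C(n - b, v)%:R 'C(n - b.+1, v)%:R.
move: n.+1%:R b.+1%:R v%:R => N B V x y z t x0 y0 N0 V0 E1 E2.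
have {y0 E2}-> : y = N * x / (N - V) by rewrite -E2; field.
have -> : (1 - B / N) * (c * (t / x)) = c * ((N - B) * t) / (N * x).
  by field; apply/andP.
by rewrite -E1; field; apply/and3P.
Qed.

Lemma prob_sizeE n v b : (v <= n)%N -> (b <= n)%N -> prob_size n v b.+1
  = polya_tail n v b.
Proof.
(* The urn needs [v > 0]; the subtree of the root is the whole tree. *)
case: (posnP v) => [->|v0] vn bn.
  rewrite /polya_tail !bin0 divr1 -[RHS](@mean_cst R n) /prob_size; apply: eq_mean => s.
  by rewrite subtree_size0 ltnS bn.
rewrite (@polya_urn (fun n => prob_size n v) 1 v) ?mul1r// => [b'|n' b'].
  by rewrite prob_size_refl mul1r.
exact: prob_size_rec.
Qed.

(** The size is 1 at time [u], and each arrival multiplies its mean by [n.+2 / n.+1]; the product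
    telescopes. *)
Lemma mean_subtree_size n u : (u <= n)%N ->
  mean (fun s : code n => (subtree_size s u)%:R) = n.+1%:R / u.+1%:R :> R.
Proof.
elim: n => [|n IH] un.
  by move: un; rewrite leqn0 => /eqP ->; rewrite /= subtree_size0 divr1.
rewrite leq_eqVlt in un; case/orP: un => [/eqP <-|un].
  rewrite divff ?natrS_neq0// -[RHS](@mean_cst R u); apply: eq_mean => s.
  by rewrite subtree_size_last.
rewrite meanS (eq_mean (g := fun s => n.+2%:R / n.+1%:R * (subtree_size s u)%:R)).
  rewrite meanZ IH//; have := natrS_neq0 n; have := natrS_neq0 u.
  by move: n.+1%:R u.+1%:R => N U U0 N0; field; apply/andP.
move=> s; under eq_bigr do rewrite subtree_size_old//= natrD.
rewrite big_split /= sum_desc sumr_const card_ord.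
rewrite -[(subtree_size s u)%:R *+ _]mulr_natl.
rewrite -[n.+2%:R]natr1; have := natrS_neq0 n.
by move: n.+1%:R => N N0; field.
Qed.

(** * Pairs of vertices: ancestry and negative correlation *)

(** The parent of [v] is uniform among [v] vertices, of which on average [v / u.+1] descend from
    [u]. *)
Lemma mean_desc v u : (u < v)%N ->
  mean (fun s : code v => (desc s u v)%:R) = u.+1%:R^-1 :> R.
Proof.
case: v => // v uv; rewrite meanS.
rewrite (eq_mean (g := fun s => v.+1%:R^-1 * (subtree_size s u)%:R)).
  rewrite meanZ mean_subtree_size//; have := natrS_neq0 v; have := natrS_neq0 u.
  by move: v.+1%:R u.+1%:R => N U U0 N0; field; apply/andP.
by move=> s; under eq_bigr do rewrite desc_new//=; rewrite sum_desc.
Qed.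

(* Being a descendant is decided at time [v], and the growth of the subtree of
   [v] after time [v] does not depend on the tree at time [v]. *)
Lemma mean_desc_subtree_size n u v b : (u < v <= n)%N -> (b <= n)%N ->
  mean (fun s : code n => (desc s u v)%:R * (b < subtree_size s v)%N%:R)
  = u.+1%:R^-1 * prob_size n v b.+1 :> R.
Proof.
move=> /andP[uv vn] bn; rewrite prob_sizeE//.
pose F n b : R :=
  mean (fun s : code n => (desc s u v)%:R * (b <= subtree_size s v)%N%:R).
rewrite -[LHS]/(F n b.+1) (@polya_urn F u.+1%:R^-1 v) ?(leq_ltn_trans _ uv)//.
  move=> b'; rewrite -(mean_desc uv) mulrC -meanZ; apply: eq_mean => s.
  by rewrite subtree_size_last ltnS leqn0 mulrC.
move=> {n vn b bn} n b vn.
rewrite /F meanS -!meanZ -meanD; apply: eq_mean => s.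
under eq_bigr do rewrite desc_old//=.
rewrite -mulr_sumr mulrCA avg_subtree_size//.
by rewrite mulrDr; congr (_ + _); exact: mulrCA.
Qed.

(** The subtrees are disjoint, so the new vertex joins at most one of them and the product of the
    two increments vanishes. *)
Lemma avg_subtree_size2 n (s : code n) u v a b : (u < v <= n)%N -> ~~ desc s u v ->
  n.+1%:R^-1 * \sum_(k < n.+1)
    ((a < subtree_size ((k, s) : code n.+1) u)%N%:R
     * (b < subtree_size ((k, s) : code n.+1) v)%N%:R)
  = (1 - a%:R / n.+1%:R - b%:R / n.+1%:R)
      * ((a < subtree_size s u)%N%:R * (b < subtree_size s v)%N%:R)
    + a%:R / n.+1%:R * ((a <= subtree_size s u)%N%:R * (b < subtree_size s v)%N%:R)
    + b%:R / n.+1%:R * ((a < subtree_size s u)%N%:R * (b <= subtree_size s v)%N%:R)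
  :> R.
Proof.
move=> /andP[uv vn] nd.
transitivity (n.+1%:R^-1 * \sum_(k < n.+1)
  ((a < subtree_size s u)%N%:R * (b < subtree_size s v)%N%:R
   + (subtree_size s u == a)%:R * (b < subtree_size s v)%N%:R * (desc s u k)%:R
   + (a < subtree_size s u)%N%:R * (subtree_size s v == b)%:R * (desc s v k)%:R : R)).
  congr (_ * _); apply: eq_bigr => k _.
  rewrite !subtree_size_old ?(leq_trans (ltnW uv))//= !natr_ltn_addb.
  have : (desc s u k)%:R * (desc s v k)%:R = 0 :> R.
    case: (boolP (desc s u k)) => du; case: (boolP (desc s v k)) => dv;
      rewrite ?mulr0 ?mul0r//.
    by rewrite (desc_chain du dv (ltnW uv)) in nd.
  move: (desc s u k)%:R (desc s v k)%:R => x y xy.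
  by rewrite mulrDl !mulrDr mulrACA xy mulr0 addr0; ring.
rewrite !big_split /= -!mulr_sumr !sum_desc sumr_const card_ord.
have := natr_eq_mul (subtree_size s u) a; have := natr_eq_mul (subtree_size s v) b.
rewrite -[(b < _)%N%:R *+ n.+1]mulr_natl.
rewrite (natr_eq_leq (subtree_size s u) a) (natr_eq_leq (subtree_size s v) b).
have := natrS_neq0 n.
move: n.+1%:R (a <= _)%N%:R (a < _)%N%:R (b <= _)%N%:R (b < _)%N%:R => N A A' B B'.
move: a%:R b%:R (subtree_size s u)%:R (subtree_size s v)%:R => x y S T N0 E1 E2.
have -> : (A - A') * B' * S = B' * ((A - A') * S) by ring.
by rewrite E2 -(mulrA A') E1; field.
Qed.

Lemma subtree_size_gt2F n (s : code n) u v a b : (u < v)%N -> ~~ desc s u v ->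
  (n < a.+1 + b)%N -> (a < subtree_size s u)%N && (b < subtree_size s v)%N = false.
Proof.
move=> uv nd; have := subtree_size_disjoint (ltnW uv) nd.
by case: (ltnP a (subtree_size s u)) => // ?; case: (ltnP b (subtree_size s v)) =>
  // ?; lia.
Qed.

(** Whether [u] is an ancestor of [v] is settled when [v] arrives, so the restricting factor is
    constant in the recursion. *)
Definition prob_size2 n u v a b : R := mean (fun s : code n =>
  (~~ desc s u v)%:R * ((a <= subtree_size s u)%N%:R * (b <= subtree_size s v)%N%:R)).

Lemma prob_size2_rec n u v a b : (u < v <= n)%N ->
  prob_size2 n.+1 u v a.+1 b.+1
  = (1 - a%:R / n.+1%:R - b%:R / n.+1%:R) * prob_size2 n u v a.+1 b.+1
    + a%:R / n.+1%:R * prob_size2 n u v a b.+1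
    + b%:R / n.+1%:R * prob_size2 n u v a.+1 b.
Proof.
move=> uvn; rewrite /prob_size2 meanS -!meanZ -!meanD; apply: eq_mean => s.
under eq_bigr do rewrite desc_old ?(andP uvn).2//=.
case: (boolP (desc s u v)) => d.
  by rewrite big1 => [|i _]; rewrite !(mul0r, mulr0, addr0).
rewrite !mul1r -avg_subtree_size2//; congr (_ * _).
by apply: eq_bigr => k _; rewrite mul1r.
Qed.

(* Subtrees of vertices in no ancestral relation compete for the new vertices,
   hence are negatively correlated. *)
Lemma prob_size2_le n u v a b : (u < v <= n)%N ->
  prob_size2 n u v a.+1 b.+1 <= prob_size n u a.+1 * prob_size n v b.+1.
Proof.
move=> /andP[uv]; elim: n a b => [|n IH] a b vn; first by move: uv vn; case: v.
rewrite leq_eqVlt in vn; case/orP: vn => [/eqP vn|].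
  rewrite -vn prob_size_refl; case: b => [|b] /=.
    rewrite mulr1; apply: le_mean => s; rewrite -natrM mulnb -natrM mulnb ler_nat.
    by case: (desc _ _ _) => //=; case: (a < _)%N; case: (0 < _)%N.
  rewrite mulr0 -[leRHS](@mean_cst R v); apply: le_mean => s.
  by rewrite subtree_size_last ltnS ltn0 !mulr0.
(* For [a + b > n] the coefficient [1 - a/(n+1) - b/(n+1)] may be negative, but then two disjoint
   subtrees of these sizes do not fit in the tree. *)
rewrite ltnS => vn; have [abn|nab] := leqP (a + b) n; last first.
  rewrite (le_trans (y := 0)) ?mulr_ge0 ?prob_size_ge0//.
  rewrite -[leRHS](@mean_cst R n.+1); apply: le_mean => s.
  case: (boolP (desc s u v)) => d; first by rewrite mul0r.
  by rewrite mul1r -natrM mulnb subtree_size_gt2F// addSn ltnS.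
rewrite prob_size2_rec ?uv// !prob_size_rec ?(leq_trans (ltnW uv))//.
have N0 : 0 < n.+1%:R :> R by rewrite ltr0n.
have ab1 : 0 <= 1 - a%:R / n.+1%:R - b%:R / n.+1%:R :> R.
  rewrite subr_ge0 lerBrDr -mulrDl ler_pdivrMr// mul1r -natrD ler_nat.
  by rewrite addnC ltnW.
(* The induction hypothesis covers positive thresholds only; at [a = 0] the coefficient vanishes. *)
have ha : a%:R / n.+1%:R * prob_size2 n u v a b.+1
    <= a%:R / n.+1%:R * (prob_size n u a * prob_size n v b.+1).
  case: a {abn ab1} => [|a]; first by rewrite !mul0r.
  by apply: ler_wpM2l; rewrite ?divr_ge0// IH.
have hb : b%:R / n.+1%:R * prob_size2 n u v a.+1 b
    <= b%:R / n.+1%:R * (prob_size n u a.+1 * prob_size n v b).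
  case: b {abn ab1 ha} => [|b]; first by rewrite !mul0r.
  by apply: ler_wpM2l; rewrite ?divr_ge0// IH.
have hab := ler_wpM2l ab1 (IH a b vn).
apply: le_trans (lerD (lerD hab ha) hb) _.
have : 0 <= a%:R / n.+1%:R :> R by rewrite divr_ge0.
have : 0 <= b%:R / n.+1%:R :> R by rewrite divr_ge0.
have := prob_size_le n u a; have := prob_size_le n v b.
move: (a%:R / _) (b%:R / _) (prob_size n u a.+1) (prob_size n u a)
  (prob_size n v b.+1) (prob_size n v b).
move=> x y A A' B B' BB AA y0 x0; rewrite -subr_ge0.
(* The product of the two marginal recursions has one extra term, for both subtrees growing at once,
   and it is nonnegative. *)
have -> : ((1 - x) * A + x * A') * ((1 - y) * B + y * B')
  - ((1 - x - y) * (A * B) + x * (A' * B) + y * (A * B'))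
  = x * y * ((A' - A) * (B' - B)) by ring.
by rewrite !mulr_ge0// subr_ge0.
Qed.

(** * First and second moments of the number of large subtrees *)

(** The ratio of tails at consecutive labels, kept free of division to include [v = n]. It drives
    both the telescoping sum and the geometric bound. *)
Lemma polya_tail_rec n v b : (v <= n)%N -> (b <= n)%N ->
  (n%:R - v%:R) * polya_tail n v.+1 b = (n%:R - b%:R - v%:R) * polya_tail n v b.
Proof.
move=> vn bn; rewrite /polya_tail.
have [vn1|nv] := ltnP v n; last first.
  have -> : v = n by lia.
  rewrite subrr mul0r; case: b bn => [|b] bn; first by rewrite subr0 subrr mul0r.
  by rewrite (@bin_small (n - b.+1) n) ?mul0r ?mulr0//; lia.
have := natr_mul_bin_left n v; have := natr_mul_bin_left (n - b) v.
rewrite natrB//; have C1 := natr_bin_neq0 vn1; have C0 := natr_bin_neq0 vn.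
have := natrS_neq0 v.
have : n%:R - v%:R != 0 :> R by rewrite subr_eq0 eqr_nat; lia.
move: 'C(n, v)%:R 'C(n, v.+1)%:R 'C(n - b, v)%:R 'C(n - b, v.+1)%:R C0 C1.
move: n%:R b%:R v%:R v.+1%:R => N B V V1 x x1 y y1 x0 x10 NV V10 E1 E2.
have -> : y1 = (N - B - V) * y / V1 by rewrite -E1; field.
have x1E : x1 = (N - V) * x / V1 by rewrite -E2; field.
by rewrite x1E; field; rewrite x0 NV V10.
Qed.

Lemma sum_prob_size n w b : (w <= n.+1)%N -> (b <= n)%N ->
  \sum_(w <= v < n.+1) prob_size n v b.+1
  = (n.+1%:R - w%:R) / b.+1%:R * polya_tail n w b.
Proof.
move=> wn bn.
(* An antidifference of the tail in [v], because [(n + 1 - v) - (n - b - v) = b + 1]; it vanishes at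
   [v = n.+1]. *)
pose g v : R := - ((n.+1%:R - v%:R) / b.+1%:R * polya_tail n v b).
rewrite (eq_big_nat _ _ (F2 := fun v => g v.+1 - g v)).
  by rewrite telescope_sumr// /g subrr !mul0r oppr0 sub0r opprK.
move=> v /andP[_ vn]; rewrite ltnS in vn; rewrite prob_sizeE// /g.
have := polya_tail_rec vn bn; have := natrS_neq0 b.
rewrite -!natr1; move: (polya_tail n v b) (polya_tail n v.+1 b) => t t1 b0 E.
have -> : (n%:R + 1 - (v%:R + 1)) / (b%:R + 1) * t1
  = ((n%:R - v%:R) * t1) / (b%:R + 1) by field.
by rewrite E; field.
Qed.

(** Used with [w = 0] for all labels, [w = K] for the late ones and [w = 1] to leave out the
    root. *)
Definition num_large (n : nat) (s : code n) w b : R :=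
  \sum_(w <= v < n.+1) (b < subtree_size s v)%N%:R.

Lemma mean_num_large n w b :
  mean (fun s : code n => num_large s w b) = \sum_(w <= v < n.+1) prob_size n v b.+1.
Proof. exact: mean_sum. Qed.

(** If [u] is not an ancestor of [v], negative correlation applies; otherwise the indicator for [u]
    is bounded by 1. *)
Lemma mean_mul_le n u v b : (u < v <= n)%N -> (b <= n)%N ->
  mean (fun s : code n => (b < subtree_size s u)%N%:R * (b < subtree_size s v)%N%:R : R)
  <= prob_size n u b.+1 * prob_size n v b.+1 + u.+1%:R^-1 * prob_size n v b.+1.
Proof.
move=> uvn bn; rewrite -mean_desc_subtree_size//.
apply: le_trans (lerD (prob_size2_le b b uvn) (lexx _)).
rewrite -meanD; apply: le_mean => s; case: (desc s u v) => /=.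
  rewrite mul0r add0r mul1r; apply: ler_piMl => //.
  by rewrite lern1 leq_b1.
by rewrite mul1r mul0r addr0.
Qed.

Lemma ler_sum_from0 (f : nat -> R) w N : (forall v, 0 <= f v) -> (w <= N)%N ->
  \sum_(w <= v < N) f v <= \sum_(0 <= v < N) f v.
Proof.
by move=> f0 wN; rewrite [leRHS](big_cat_nat (n := w))//= lerDr sumr_ge0.
Qed.

(** In the expanded square the diagonal contributes the mean, and each ancestral excess occurs
    twice, once per order of the pair. *)
Lemma mean_num_large_sqr n w b : (w <= n.+1)%N -> (b <= n)%N ->
  mean (fun s : code n => num_large s w b ^+ 2)
  <= (\sum_(w <= v < n.+1) prob_size n v b.+1) ^+ 2
     + \sum_(w <= v < n.+1) prob_size n v b.+1
     + 2 * \sum_(0 <= u < n.+1) u.+1%:R^-1 * \sum_(u.+1 <= v < n.+1) prob_size n v b.+1.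
Proof.
move=> wn bn.
pose c u v : R := (u < v)%N%:R * (u.+1%:R^-1 * prob_size n v b.+1).
pose D : R := \sum_(w <= u < n.+1) \sum_(w <= v < n.+1) c u v.
have DE : D <= \sum_(0 <= u < n.+1)
                  u.+1%:R^-1 * \sum_(u.+1 <= v < n.+1) prob_size n v b.+1.
  apply: le_trans (ler_sum_from0 _ wn); last first.
    by move=> u; rewrite mulr_ge0 ?invr_ge0// sumr_ge0// => v _; apply: prob_size_ge0.
  rewrite /D big_nat [leRHS]big_nat; apply: ler_sum => u /andP[wu un].
  rewrite (big_cat_nat (n := u.+1))//=; last exact: leqW.
  rewrite big_nat big1 ?add0r => [|v /andP[_]]; last first.
    by rewrite /c ltnS leqNgt => /negbTE ->; rewrite mul0r.
  rewrite mulr_sumr big_nat [leRHS]big_nat; apply: ler_sum => v /andP[uv _].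
  by rewrite /c uv mul1r.
have qle v : prob_size n v b.+1 <= 1.
  rewrite -[leRHS](@mean_cst R n); apply: le_mean => s.
  by rewrite lern1 leq_b1.
have pair_le u v : (u < n.+1)%N -> (v < n.+1)%N ->
  mean (fun s : code n => (b < subtree_size s u)%N%:R * (b < subtree_size s v)%N%:R : R)
  <= prob_size n u b.+1 * prob_size n v b.+1 + (u == v)%:R * prob_size n v b.+1
    + c u v + c v u.
  rewrite !ltnS => un vn; rewrite /c; case: (ltngtP u v) => uv.
  - by rewrite !mul0r !addr0 mul1r mean_mul_le ?uv.
  - rewrite !mul0r !addr0 mul1r.
    rewrite (eq_mean (g := fun s => (b < subtree_size s v)%N%:R
      * (b < subtree_size s u)%N%:R)).
      by rewrite [prob_size n u _ * _]mulrC mean_mul_le ?uv.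
    by move=> s; rewrite mulrC.
  - rewrite uv !mul0r !addr0 mul1r.
    rewrite (eq_mean (g := fun s : code n => (b < subtree_size s v)%N%:R)).
      by rewrite lerDr mulr_ge0 ?prob_size_ge0.
    by move=> s; case: (b < _)%N; rewrite ?mulr0 ?mulr1.
have -> : mean (fun s : code n => num_large s w b ^+ 2)
  = \sum_(w <= u < n.+1) \sum_(w <= v < n.+1)
      mean (fun s : code n => (b < subtree_size s u)%N%:R
        * (b < subtree_size s v)%N%:R : R).
  rewrite (eq_mean (g := fun s => \sum_(w <= u < n.+1) \sum_(w <= v < n.+1)
      (b < subtree_size s u)%N%:R * (b < subtree_size s v)%N%:R)).
    by rewrite mean_sum; apply: eq_bigr => u _; rewrite mean_sum.
  by move=> s; rewrite expr2 big_distrlr.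
apply: (@le_trans _ _ (\sum_(w <= u < n.+1) \sum_(w <= v < n.+1)
  (prob_size n u b.+1 * prob_size n v b.+1 + (u == v)%:R * prob_size n v b.+1
    + c u v + c v u))).
  rewrite big_nat [leRHS]big_nat; apply: ler_sum => u /andP[_ un].
  rewrite big_nat [leRHS]big_nat; apply: ler_sum => v /andP[_ vn].
  exact: pair_le.
under eq_bigr do rewrite !big_split.
rewrite !big_split /= -big_distrlr /= -expr2.
have -> : \sum_(w <= u < n.+1) \sum_(w <= v < n.+1) c v u = D.
  exact: exchange_big.
rewrite -/D -addrA; apply: lerD; last by rewrite mulr2n mulrDl !mul1r lerD.
rewrite lerD2l exchange_big /= big_nat [leRHS]big_nat; apply: ler_sum => v vwn.
rewrite -mulr_suml (bigD1_seq v) ?iota_uniq ?mem_index_iota//= eqxx.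
by rewrite big1 ?addr0 ?mul1r// => u /negbTE ->.
Qed.

(** * Harmonic sums and numerical estimates *)

Lemma invr_le_lnB u : u.+2%:R^-1 <= ln u.+2%:R - ln u.+1%:R :> R.
Proof.
have u2 : 0 < u.+2%:R :> R by rewrite ltr0n.
have u1 : 0 < u.+1%:R :> R by rewrite ltr0n.
rewrite -lerN2 opprB -ln_div ?posrE//.
have -> : u.+1%:R / u.+2%:R = 1 + - u.+2%:R^-1 :> R.
  rewrite -[u.+2%:R]natr1 in u2 *; move: u.+1%:R u1 u2 => x u1 u2.
  by field; rewrite lt0r_neq0.
by apply: le_ln1Dx; rewrite ltrN2 invf_lt1// ltr1n.
Qed.

Lemma harmonic_le K : (0 < K)%N ->
  \sum_(0 <= u < K) u.+1%:R^-1 <= 1 + ln K%:R :> R.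
Proof.
case: K => // K _; elim: K => [|K IH].
  by rewrite big_nat1 ln1 invr1 addr0.
rewrite big_nat_recr//=; apply: le_trans (lerD IH (invr_le_lnB K)) _.
by lra.
Qed.

Lemma ln_ge_half K : (2 <= K)%N -> 1 <= 2 * ln K%:R :> R.
Proof.
move=> K2; have := invr_le_lnB 0; rewrite ln1 subr0 => h.
have : ln 2 <= ln K%:R :> R by rewrite ler_ln ?posrE ?ler_nat// ltr0n; lia.
by lra.
Qed.

(* [17 / 48 = 0.34 * 25 / 24]: this bounds by [0.34 K] the expected number of
   large subtrees hanging from labels [>= K]. *)
Lemma expRN_2524 : expR (- (25 / 24)) <= 17 / 48 :> R.
Proof.
have step (a c x : R) k : 0 <= a -> a <= x -> c <= a ^+ k -> c <= x ^+ k.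
  by move=> a0 ax /le_trans; apply; rewrite lerXn2r ?nnegrE// (le_trans a0).
(* Start from [1 + x <= exp x] at [x = 1/240] and take powers 5, 5, 5, 2, rounding down to short
   fractions each time; [250/240 = 25/24]. *)
have h0 : 241 / 240 <= expR (240^-1) :> R.
  by apply: le_trans (expR_ge1Dx _); lra.
have h1 := step (241 / 240) (389 / 381) _ 5 ltac:(lra) h0 ltac:(lra).
have h2 := step (389 / 381) (152 / 137) _ 5 ltac:(lra) h1 ltac:(lra).
have h3 := step (152 / 137) (116 / 69) _ 5 ltac:(lra) h2 ltac:(lra).
have h4 := step (116 / 69) (602 / 213) _ 2 ltac:(lra) h3 ltac:(lra).
rewrite -!exprM -expRM_natl in h4.
have -> : - (25 / 24) = - ((5 * 5 * 5 * 2)%N%:R * 240^-1) :> R by lra.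
have p : 0 < (17 / 48)^-1 :> R by lra.
rewrite expRN -[leRHS]invrK lef_pV2 ?posrE ?expR_gt0//.
by apply: le_trans h4; lra.
Qed.

(** The tail is the product of [(n - b - j)/(n - j)] over [j < v], and each factor is at most its
    value at [j = 0]. *)
Lemma polya_tail_le_expr n v b : (v <= n)%N -> (b <= n)%N -> (0 < n)%N ->
  polya_tail n v b <= (1 - b%:R / n%:R) ^+ v.
Proof.
move=> + bn n0; have n0R : 0 < n%:R :> R by rewrite ltr0n.
have y1 : 0 <= 1 - b%:R / n%:R :> R.
  by rewrite subr_ge0 ler_pdivrMr// mul1r ler_nat.
elim: v => [|v IH] vn; first by rewrite /polya_tail !bin0 divr1.
have nv : 0 < n%:R - v%:R :> R by rewrite subr_gt0 ltr_nat.
rewrite -(ler_pM2l nv) (polya_tail_rec (ltnW vn) bn).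
rewrite exprS [leRHS]mulrA.
have A0 : 0 <= (n%:R - v%:R) * (1 - b%:R / n%:R) :> R by rewrite mulr_ge0// ltW.
apply: (le_trans _ (ler_wpM2l A0 (IH (ltnW vn)))).
rewrite ler_wpM2r ?polya_tail_ge0// mulrBr mulr1 addrAC lerD2l lerN2.
by rewrite mulrCA ler_piMr// ler_pdivrMr// mul1r gerBl.
Qed.

(** For [u < K] the inner sum is at most the full sum [E]. For [u >= K] the weight is at most [1/K]
    and the inner sum at most [E] times the tail at [u.+1]; these tails again sum to at most [E]. *)
Lemma sum_sum_prob_size_le n b K (E : R) : (b <= n)%N -> (0 < K <= n)%N ->
  E = n.+1%:R / b.+1%:R ->
  \sum_(0 <= u < n.+1) u.+1%:R^-1 * \sum_(u.+1 <= v < n.+1) prob_size n v b.+1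
  <= E * (\sum_(0 <= u < K) u.+1%:R^-1 + E / K%:R).
Proof.
move=> bn /andP[K0 Kn] EE.
have E0 : 0 <= E by rewrite EE divr_ge0.
have sumE : \sum_(0 <= v < n.+1) prob_size n v b.+1 = E.
  by rewrite sum_prob_size// subr0 EE /polya_tail !bin0 divr1 mulr1.
have tail0 : polya_tail n n.+1 b = 0 by rewrite /polya_tail bin_small ?mul0r//; lia.
rewrite (big_cat_nat (n := K))//=; last exact: leqW.
rewrite mulrDr; apply: lerD.
  rewrite mulr_sumr big_nat [leRHS]big_nat; apply: ler_sum => u /andP[_ uK].
  rewrite mulrC ler_wpM2r ?invr_ge0// -sumE; apply: ler_sum_from0; last by lia.
  by move=> v; apply: prob_size_ge0.
(* The shift from [u] to [u.+1] reaches the index [n.+1], where the tail is 0. *)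
have -> : E * (E / K%:R) = \sum_(0 <= v < n.+2) K%:R^-1 * (E * polya_tail n v b).
  rewrite -!mulr_sumr big_nat_recr//= tail0 addr0.
  have -> : \sum_(0 <= v < n.+1) polya_tail n v b = E.
    rewrite -[RHS]sumE big_nat [RHS]big_nat; apply: eq_bigr => v /andP[_ vn].
    by rewrite prob_sizeE.
  by rewrite mulrA mulrC.
have t0 v : 0 <= K%:R^-1 * (E * polya_tail n v b).
  by rewrite !mulr_ge0 ?invr_ge0 ?polya_tail_ge0.
apply: le_trans (@ler_sum_from0 _ K.+1 n.+2 t0 _); last by lia.
rewrite [leRHS]big_add1 /= big_nat [leRHS]big_nat; apply: ler_sum => u /andP[Ku un].
apply: ler_pM; rewrite ?invr_ge0 ?sumr_ge0//.
- by move=> v _; apply: prob_size_ge0.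
- by rewrite lef_pV2 ?posrE ?ltr0n// ler_nat; lia.
- rewrite sum_prob_size// EE ler_wpM2r ?polya_tail_ge0// ler_wpM2r ?invr_ge0//.
  by rewrite gerBl.
Qed.

(** * Chebyshev bound for the good event *)

Lemma mean_num_large_variance n w b e : (w <= n.+1)%N -> (b <= n)%N ->
  e = \sum_(w <= v < n.+1) prob_size n v b.+1 ->
  mean (fun s : code n => (num_large s w b - e) ^+ 2)
  <= e + 2 * \sum_(0 <= u < n.+1)
                u.+1%:R^-1 * \sum_(u.+1 <= v < n.+1) prob_size n v b.+1.
Proof.
move=> wn bn eE; have := mean_num_large_sqr wn bn; rewrite -eE => h.
rewrite (eq_mean (g := fun s => num_large s w b ^+ 2 + (- (2 * e) * num_large s w b
  + e ^+ 2))).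
  rewrite !meanD meanZ mean_cst mean_num_large -eE.
  by move: h; rewrite expr2; lra.
by move=> s; ring.
Qed.

(** With [b] just above [25 (n+1) / (24 K)], the mean [(n+1)/(b+1)] lies slightly below [0.96 K]. *)
Lemma threshold K n : (2 <= K)%N -> (400 * K <= n.+1)%N ->
  exists2 b : nat, (0 < b < n)%N &
    25 * n.+1%:R <= 24 * K%:R * b%:R :> R /\
    24 * K%:R * (b%:R - 1) <= 25 * n.+1%:R :> R.
Proof.
move=> K2 Kn; exists ((25 * n.+1) %/ (24 * K)).+1.
  have := leq_trunc_div (25 * n.+1) (24 * K).
  by set c := (_ %/ _)%N => h; have : (c * 48 <= 25 * n.+1)%N; nia.
split.
  by rewrite -!natrM ler_nat [leqRHS]mulnC ltnW// ltn_ceil// muln_gt0; lia.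
by rewrite -[(_ %/ _).+1%:R]natr1 addrK -!natrM ler_nat [leqLHS]mulnC leq_trunc_div.
Qed.

(** The difference in the second condition counts large subtrees at labels [< K]; the third rules
    out non-root subtrees with more than [n - b] vertices. *)
Definition balanced (n : nat) (s : code n) (K b : nat) : bool :=
  [&& num_large s 0 b <= K%:R, 6 / 10 * K%:R <= num_large s 0 b - num_large s K b
    & num_large s 1 (n - b) == 0].

(** A pointwise form of the Chebyshev and Markov inequalities: each way of failing makes some other
    term at least 1. *)
Lemma balanced_ge n (s : code n) K b (mu la : R) : (0 < K)%N ->
  955 / 1000 * K%:R <= mu -> mu <= 96 / 100 * K%:R -> la <= 34 / 100 * K%:R ->
  1 <= (balanced s K b)%:R
       + (200 / K%:R) ^+ 2 * ((num_large s 0 b - mu) ^+ 2)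
       + (100 / K%:R) ^+ 2 * ((num_large s K b - la) ^+ 2)
       + num_large s 1 (n - b).
Proof.
move=> K0; have k0 : 0 < K%:R :> R by rewrite ltr0n.
have B0 : 0 <= num_large s 1 (n - b) by rewrite sumr_ge0.
rewrite /balanced -!exprMn; move: (num_large s 0 b) (num_large s K b) => N L.
have big (c x : R) : 0 <= c -> K%:R <= c * x \/ K%:R <= - (c * x) ->
    1 <= (c / K%:R * x) ^+ 2.
  move=> c0 h; rewrite mulrAC -real_normK ?num_real// exprn_ege1//.
  rewrite normrM normfV (ger0_norm (ltW k0)) ler_pdivlMr// mul1r ler_normr.
  exact/orP.
have sq0 (x : R) : 0 <= x ^+ 2 by exact: sqr_ge0.
move=> mu1 mu2 la1.
have [NK|KN] := leP N K%:R; last first.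
  have := big 200 (N - mu) ltac:(lra) ltac:(left; lra).
  by have := sq0 (100 / K%:R * (L - la)); rewrite /= add0r; lra.
have [NL|LN] := leP (6 / 10 * K%:R) (N - L); last first.
  (* Either [N <= 0.95 K], which is [K/200] below its mean, or [L > 0.35 K], which is [K/100] above
     its mean. *)
  rewrite /= add0r; have [h|h] := leP N (95 / 100 * K%:R).
    have := big 200 (N - mu) ltac:(lra) ltac:(right; lra).
    by have := sq0 (100 / K%:R * (L - la)); lra.
  have := big 100 (L - la) ltac:(lra) ltac:(left; lra).
  by have := sq0 (200 / K%:R * (N - mu)); lra.
have [_|nz] := eqVneq (num_large s 1 (n - b)) 0; rewrite /=.
  by have := sq0 (200 / K%:R * (N - mu)); have := sq0 (100 / K%:R * (L - la)); lra.
suff : 1 <= num_large s 1 (n - b).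
  have := sq0 (200 / K%:R * (N - mu)); have := sq0 (100 / K%:R * (L - la)).
  by rewrite /=; lra.
by move: nz; rewrite /num_large -natr_sum pnatr_eq0 ler1n lt0n.
Qed.

Lemma mean_balanced K n : (2 <= K)%N -> (400 * K <= n.+1)%N ->
  exists2 b : nat, (0 < b < n)%N &
    1 - (700 * 1000) * ln K%:R / K%:R <= mean (fun s : code n =>
      (balanced s K b)%:R) :> R.
Proof.
move=> K2 Kn; have [b bn [b1 b2]] := threshold K2 Kn; exists b => //.
case/andP: bn => b0 bn; have Kn' : (K <= n)%N by clear -K2 Kn; lia.
have n_gt0 : (0 < n)%N by apply: leq_trans Kn'; apply: ltnW.
have n0 : 0 < n%:R :> R by rewrite ltr0n.
pose E : R := n.+1%:R / b.+1%:R.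
pose mu : R := \sum_(0 <= v < n.+1) prob_size n v b.+1.
pose la : R := \sum_(K <= v < n.+1) prob_size n v b.+1.
pose D : R :=
  \sum_(0 <= u < n.+1) u.+1%:R^-1 * \sum_(u.+1 <= v < n.+1) prob_size n v b.+1.
have k2 : 2 <= K%:R :> R by rewrite ler_nat.
have M400 : 400 * K%:R <= n.+1%:R :> R by rewrite -natrM ler_nat.
have b10 : 0 < b.+1%:R :> R by rewrite ltr0n.
have muE : mu = E.
  by rewrite /mu sum_prob_size 1?ltnW// subr0 /polya_tail !bin0 divr1 mulr1.
have mu_le : mu <= 96 / 100 * K%:R.
  rewrite muE ler_pdivrMr// -[b.+1%:R]natr1; nra.
(* Since [400 K <= n + 1], rounding costs at most [2/400], and [1 / (25/24 + 2/400) > 0.955]. *)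
have mu_ge : 955 / 1000 * K%:R <= mu.
  rewrite muE ler_pdivlMr// -[b.+1%:R]natr1; nra.
have la_le : la <= 34 / 100 * K%:R.
  (* [(1 - b/n)^K <= exp(- K b / n)] and [K b / n >= 25/24]. *)
  have tl : polya_tail n K b <= 17 / 48.
    apply: le_trans (polya_tail_le_expr Kn' (ltnW bn) n_gt0) _.
    have hy : 1 - b%:R / n%:R <= expR (- (b%:R / n%:R)) :> R.
      exact: expR_ge1Dx.
    apply: le_trans (lerXn2r K _ _ hy) _; rewrite ?nnegrE ?expR_ge0//.
      by rewrite subr_ge0 ler_pdivrMr// mul1r ler_nat ltnW.
    rewrite -expRM_natl; apply: le_trans expRN_2524; rewrite ler_expR mulrN lerN2.
    rewrite mulrA ler_pdivlMr//; move: b1; rewrite -[n.+1%:R]natr1; clear; lra.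
  have laE : la <= E * polya_tail n K b.
    rewrite /la sum_prob_size 1?ltnW// 1?ltnW// ler_wpM2r ?polya_tail_ge0//.
    by rewrite ler_wpM2r ?invr_ge0// gerBl.
  apply: le_trans laE _; rewrite -muE.
  apply: le_trans (ler_pM _ _ mu_le tl) _; rewrite ?polya_tail_ge0//;
    clear -mu_ge k2; lra.
(* The sum equals [b / (n - b + 1)], with [b] about [25 n / (24 K)]. *)
have B_le : \sum_(1 <= v < n.+1) prob_size n v (n - b).+1 <= 3 / K%:R.
  rewrite sum_prob_size// ?leq_subr// /polya_tail !bin1 subKn ?(ltnW bn)//.
  rewrite -[n.+1%:R]natr1 addrK.
  have d0 : 0 < (n - b).+1%:R :> R by rewrite ltr0n.
  rewrite mulrAC mulrCA mulfV ?mulr1 ?lt0r_neq0//.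
  rewrite ler_pdivrMr// mulrAC ler_pdivlMr; last by clear -k2; lra.
  rewrite -[(n - b).+1%:R]natr1 natrB 1?ltnW//.
  move: b1 b2 M400; rewrite -[n.+1%:R]natr1; clear -k2; nra.
have D_le : D <= K%:R * (2 + ln K%:R).
  apply: le_trans (@sum_sum_prob_size_le n b K E (ltnW bn) _ erefl) _.
    by rewrite (ltnW K2).
  have := harmonic_le (ltnW K2); move: mu_le mu_ge; rewrite muE.
  set H := \sum_(0 <= u < K) _ => E1 E2 HH.
  have E3 : E / K%:R <= 1 by rewrite ler_pdivrMr; clear -E1 k2; lra.
  have E4 : 0 <= E / K%:R by rewrite divr_ge0//; clear -E2 k2; lra.
  have H0 : 0 <= H by rewrite sumr_ge0// => u _; rewrite invr_ge0.
  by apply: ler_pM; clear -E1 E2 E3 E4 H0 HH k2; lra.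
have VN := mean_num_large_variance (leq0n _) (ltnW bn) (erefl mu).
have VL := mean_num_large_variance (leqW Kn') (ltnW bn) (erefl la).
rewrite -/D in VN VL.
have : mean (fun _ : code n => 1 : R) <= mean (fun s : code n => (balanced s K b)%:R
       + (200 / K%:R) ^+ 2 * ((num_large s 0 b - mu) ^+ 2)
       + (100 / K%:R) ^+ 2 * ((num_large s K b - la) ^+ 2)
       + num_large s 1 (n - b)).
  by apply: le_mean => s; exact: balanced_ge (ltnW K2) mu_ge mu_le la_le.
rewrite mean_cst !meanD !meanZ mean_num_large => h.
have lnK := ln_ge_half K2.
have k0 : 0 < K%:R :> R by rewrite ltr0n ltnW.
have KlnK : K%:R <= 2 * (K%:R * ln K%:R) :> R.
  by rewrite mulrCA ler_peMr// ltW.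
(* [0.96 K + 2 K (2 + ln K)] is at most [12 K ln K], by [K <= 2 K ln K]. *)
have VN' : mean (fun s : code n => (num_large s 0 b - mu) ^+ 2)
  <= 12 * (K%:R * ln K%:R).
  by apply: le_trans VN _; clear -mu_le D_le KlnK k2; lra.
have VL' : mean (fun s : code n => (num_large s K b - la) ^+ 2)
  <= 12 * (K%:R * ln K%:R).
  by apply: le_trans VL _; clear -la_le D_le KlnK k2; lra.
have kn0 : K%:R != 0 :> R by rewrite lt0r_neq0.
(* The total 480000 + 120000 + 6 stays below 700000. *)
have c1 : (200 / K%:R) ^+ 2 * (12 * (K%:R * ln K%:R))
  = (480 * 1000) * (ln K%:R / K%:R) :> R.
  by field.
have c2 : (100 / K%:R) ^+ 2 * (12 * (K%:R * ln K%:R))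
  = (120 * 1000) * (ln K%:R / K%:R) :> R.
  by field.
have := ler_wpM2l (sqr_ge0 (200 / K%:R)) VN'; rewrite c1.
have := ler_wpM2l (sqr_ge0 (100 / K%:R)) VL'; rewrite c2.
have : 3 / K%:R <= 6 * (ln K%:R / K%:R) :> R.
  by rewrite mulrA ler_wpM2r ?invr_ge0//; clear -lnK; lra.
have : 0 <= ln K%:R / K%:R :> R by rewrite divr_ge0//; clear -lnK; lra.
move: h B_le; rewrite -[700 * 1000 * _ / _]mulrA.
move: (_ ^+ 2 * mean _) => X; move: (_ ^+ 2 * mean _) => Y.
move: (mean _) (\sum_(_ <= _ < _) _) (3 / K%:R) (ln K%:R / K%:R) => G S T L.
clear; lra.
Qed.

End Moments.

(** * Centrality in terms of subtree sizes *)

(** The root and labels beyond [n] get the default value 0. *)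
Fixpoint parent (n : nat) : code n -> nat -> nat :=
  match n with
  | 0 => fun _ _ => 0%N
  | n'.+1 => fun s w => if w == n'.+1 then (s.1 : nat) else parent s.2 w
  end.

Lemma parent_lt n (s : code n) w : (0 < w <= n)%N -> (parent s w < w)%N.
Proof.
elim: n s => [|n IH] s /=; first by case: w.
case: eqP => [->//|ne /andP[w0 wn]]; apply: IH; lia.
Qed.

Lemma desc_parent n (s : code n) v w : (0 < w <= n)%N ->
  desc s v w = (v == w) || desc s v (parent s w).
Proof.
elim: n s => [|n IH] s; first by case: w.
move=> /andP[w0 wn]; rewrite {1}/desc -/desc /=; case: eqP => [wn1|ne].
  by rewrite desc_old// -ltnS.
by rewrite desc_old ?IH//; [|have := @parent_lt n s.2 w]; lia.
Qed.

Lemma tree_edge n (s : code n) (x y : 'I_n.+1) : (x, y) \in tree s ->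
  ((0 < x)%N /\ y = parent s x :> nat) \/ ((0 < y)%N /\ x = parent s y :> nat).
Proof.
elim: n s x y => [|n IH] s x y /=; first by rewrite finset.in_set0.
rewrite /attach finset.in_setU finset.in_set2 => /orP[/imsetP[[a b] /= ab [-> ->]] /=|].
  by rewrite !ltn_eqF//; exact: IH.
by case/orP => /eqP[-> ->] /=; rewrite eqxx; [right|left].
Qed.

Lemma tree_parent n (s : code n) (u w : 'I_n.+1) : (0 < w)%N ->
  u = parent s w :> nat -> (u, w) \in tree s /\ (w, u) \in tree s.
Proof.
elim: n s u w => [|n IH] s u w w0 /=; first by case: w w0 => -[].
rewrite /attach !(finset.in_setU, finset.in_set1); case: eqP => [wn1 us|ne us].
  have -> : w = ord_max by apply: val_inj.
  have -> : u = old_vertex s.1 by apply: val_inj.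
  by rewrite !eqxx !orbT.
have wn : (w < n.+1)%N by rewrite ltn_neqAle -ltnS ltn_ord andbT; apply/eqP.
have un : (u < n.+1)%N by rewrite us (ltn_trans (parent_lt _ _))// w0 -ltnS.
have [h1 h2] := IH s.2 (Ordinal un) (Ordinal wn) w0 us.
have oldu : u = old_vertex (Ordinal un) by apply: val_inj.
have oldw : w = old_vertex (Ordinal wn) by apply: val_inj.
split; apply/orP; left; apply/imsetP.
  by exists (Ordinal un, Ordinal wn); rewrite //= -oldu -oldw.
by exists (Ordinal wn, Ordinal un); rewrite //= -oldu -oldw.
Qed.

Lemma card_desc n (s : code n) v :
  #|[set w : 'I_n.+1 | desc s v w]%SET| = subtree_size s v.
Proof.
by rewrite /subtree_size -sum1_card big_mkcond; apply: eq_bigr => w _; rewrite inE.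
Qed.

Lemma card_ndesc n (s : code n) v :
  #|[set w : 'I_n.+1 | ~~ desc s v w]%SET| = (n.+1 - subtree_size s v)%N.
Proof.
rewrite cardsCs card_ord -card_desc; congr (_ - _)%N; apply: eq_card => w.
by rewrite !inE negbK.
Qed.

(** The path from the root to a non-descendant of [v] avoids [v], so all non-descendants lie in the
    component of 0. *)
Lemma psi_ge n (s : code n) (v : 'I_n.+1) :
  (n.+1 - subtree_size s v <= psi (tree s) v)%N.
Proof.
rewrite -card_ndesc.
apply: leq_trans (leq_bigmax (ord0 : 'I_n.+1)); apply: subset_leq_card.
apply/fintype.subsetP => w; rewrite !inE.
have [k] := ubnP w; elim: k w => // k IH w wk nd.
have [w0|w0] := posnP w.
  by rewrite (_ : w = ord0) ?connect0//; apply: val_inj.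
have wb : (0 < w <= n)%N by rewrite w0 -ltnS ltn_ord.
have pw := parent_lt s wb.
have pn : (parent s w < n.+1)%N by apply: ltn_trans pw _.
move: (nd); rewrite desc_parent// negb_or => /andP[vw npar].
apply: connect_trans (IH (Ordinal pn) _ npar) _; first exact: leq_trans pw _.
apply: connect1; rewrite /remove_edges_at /=.
have [-> _] := tree_parent (u := Ordinal pn) w0 erefl.
have -> : w != v by apply: contraNneq vw => ->.
rewrite andbT /=; apply: contraNneq npar => <-.
by rewrite desc_refl // -ltnS.
Qed.

(** The only edge leaving the subtree of [c] joins [c] to its parent, and one of these two is
    [v]. *)
Lemma desc_closed n (s : code n) (v : 'I_n.+1) (c : nat) :
  c = v \/ parent s c = v ->
  fingraph.closed (remove_edges_at (tree s) v) [set w : 'I_n.+1 | desc s c w]%SET.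
Proof.
have step (x y : 'I_n.+1) : (0 < x)%N -> y = parent s x :> nat -> x != v -> y != v ->
    c = v \/ parent s c = v -> desc s c x = desc s c y.
  move=> x0 yx xv yv cv; have xb : (0 < x <= n)%N by rewrite x0 -ltnS ltn_ord.
  rewrite (desc_parent s c xb) -yx.
  case: eqP => //= cx; case: cv => cv.
    by case/eqP: xv; apply: val_inj; rewrite /= -cx.
  by case/eqP: yv; apply: val_inj; rewrite /= yx -cx.
move=> cv x y /and3P[/tree_edge[[x0 yx]|[y0 xy]] xv yv]; rewrite !inE.
  exact: step.
by apply/esym; apply: step.
Qed.

Lemma desc_child n (s : code n) v x : (x <= n)%N -> desc s v x -> v != x ->
  exists c, [/\ (0 < c <= n)%N, parent s c = v & desc s c x].
Proof.
have [k] := ubnP x; elim: k x => // k IH x xk xn dx vx.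
have x0 : (0 < x)%N.
  by case: x dx vx {xk xn} => // /desc_leq /andP[]; rewrite leqn0 => ->.
have xb : (0 < x <= n)%N by rewrite x0.
have px := parent_lt s xb.
move: dx; rewrite desc_parent// (negbTE vx) /= => dp.
have [vp|vp] := eqVneq v (parent s x); first by exists x; rewrite desc_refl.
have [||c [c0 cv dc]] := IH (parent s x) _ _ dp vp; [lia|lia|].
by exists c; split => //; rewrite desc_parent// dc orbT.
Qed.

Lemma component_leq n (e : rel 'I_n) (A : {set 'I_n}) x : fingraph.closed e A ->
  x \in A -> (#|component e x| <= #|A|)%N.
Proof.
move=> cA xA; apply: subset_leq_card; apply/fintype.subsetP => y; rewrite inE.
by move=> /(closed_connect cA) <-.
Qed.

(** A component is contained in the complement of the subtree of [v], in [{v}] (whence [0 < k]), or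
    in the subtree of a child of [v]. *)
Lemma psi_le n (s : code n) (v : 'I_n.+1) k : (0 < k)%N ->
  (n.+1 - subtree_size s v <= k)%N ->
  (forall c, (0 < c <= n)%N -> (subtree_size s c <= k)%N) ->
  (psi (tree s) v <= k)%N.
Proof.
move=> k0 vk ck; apply/bigmax_leqP => x _.
have [d|nd] := boolP (desc s v x); last first.
  apply: leq_trans vk; rewrite -card_ndesc; apply: component_leq; last by rewrite inE.
  move=> y z yz; have := desc_closed (or_introl (erefl (v : nat))) yz.
  by rewrite !inE => ->.
have [<-|vx] := eqVneq v x.
  apply: leq_trans k0; rewrite -(cards1 v); apply: component_leq; last by rewrite inE.
  by move=> y z /and3P[_ yv zv]; rewrite !inE (negbTE yv) (negbTE zv).
have xn : (x <= n)%N by rewrite -ltnS.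
have [c [c0 cv dc]] := desc_child xn d vx.
apply: leq_trans (ck c c0); rewrite -card_desc.
by apply: component_leq (desc_closed (or_intror cv)) _; rewrite inE.
Qed.

(** * Early labels among the most central vertices *)

(** Quantifying over all tie-breaking permutations makes this a property of the tree alone. *)
Definition early_central n (t : graph n.+1) (K : nat) : bool :=
  [forall p : {perm 'I_n.+1},
    6 * K <= 10 * #|[set v in most_central t p K | (v < K)%N]%SET|]%N.

(** Only other members of the sublevel set can rank above one of its members. *)
Lemma most_central_sub n (t : graph n) p K k :
  (#|[set v | (psi t v <= k)%N]%SET| <= K)%N ->
  [set v | (psi t v <= k)%N]%SET \subset most_central t p K.
Proof.
move=> cK; apply/fintype.subsetP => v; rewrite !inE => vk.
apply: leq_trans cK; apply: proper_card; apply/properP; split.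
  apply/fintype.subsetP => u; rewrite !inE /more_central.
  by case/orP => [/ltnW/leq_trans|/andP[/eqP -> _]]; first apply.
by exists v; rewrite !inE // /more_central !ltnn andbF.
Qed.

Section Balanced.
Variable R : realType.

Lemma card_num_large n (s : code n) w b : (w <= n.+1)%N ->
  num_large R s 0 b - num_large R s w b
  = #|[set v : 'I_n.+1 | (b < subtree_size s v)%N && (v < w)%N]%SET|%:R.
Proof.
move=> wn; rewrite /num_large (big_cat_nat (n := w))//= addrK big_mkord.
rewrite (big_ord_widen _ (fun v => (b < subtree_size s v)%N%:R) wn) -sum1_card natr_sum.
rewrite big_mkcond [RHS]big_mkcond /=; apply: eq_bigr => v _; rewrite inE andbC.
by case: (v < w)%N => //=; case: (b < _)%N.
Qed.

Lemma balanced_early_central n (s : code n) K b : (0 < b < n)%N ->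
  (K <= n.+1)%N -> balanced R s K b -> early_central (tree s) K.
Proof.
move=> /andP[b0 bn] Kn /and3P[N_le NL /eqP B0]; apply/forallP => p.
have ck c : (0 < c <= n)%N -> (subtree_size s c <= n - b)%N.
  move=> /andP[c0 cn]; rewrite leqNgt; apply/negP => h.
  move/eqP: B0; rewrite /num_large psumr_eq0 => [/allP/(_ c)|//].
  by rewrite mem_index_iota c0 ltnS cn h /= oner_eq0 => /(_ isT).
have psiE (v : 'I_n.+1) : (psi (tree s) v <= n - b)%N = (b < subtree_size s v)%N.
  apply/idP/idP => [h|h]; first by have := leq_trans (psi_ge s v) h; lia.
  by apply: psi_le => //; lia.
have GE : [set v | (psi (tree s) v <= n - b)%N]%SET
    = [set v : 'I_n.+1 | (b < subtree_size s v)%N]%SET.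
  by apply/finset.setP => v; rewrite !inE psiE.
have GK : (#|[set v | (psi (tree s) v <= n - b)%N]%SET| <= K)%N.
  (* At [w = n.+1] the subtracted sum is empty, so this counts all large subtrees. *)
  have := card_num_large s b (leqnn n.+1).
  rewrite {2}/num_large big_geq// subr0 => NE; move: N_le; rewrite NE ler_nat.
  rewrite GE; apply: leq_trans; apply: subset_leq_card.
  by apply/fintype.subsetP => v; rewrite !inE ltn_ord andbT.
have sub_mc := most_central_sub p GK.
have h : (#|[set v : 'I_n.+1 | (b < subtree_size s v)%N && (v < K)%N]%SET| <=
    #|[set v in most_central (tree s) p K | (v < K)%N]%SET|)%N.
  apply: subset_leq_card; apply/fintype.subsetP => v; rewrite !inE => /andP[bv ->].
  have /(fintype.subsetP sub_mc) : v \in [set v | (psi (tree s) v <= n - b)%N]%SET.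
    by rewrite inE psiE.
  by rewrite inE andbT.
apply: leq_trans (leq_mul (leqnn 10) h).
rewrite -(ler_nat R) !natrM -card_num_large//; move: NL; lra.
Qed.

End Balanced.

(** * From codes to the law of the random trees *)

Lemma old_vertex_inj n : injective (@old_vertex n).
Proof. by move=> x y /(congr1 val) /= xy; apply: val_inj. Qed.

Lemma old_in_attach n (t : graph n) k x y :
  ((old_vertex x, old_vertex y) \in attach t k) = ((x, y) \in t).
Proof.
have old_max z : (old_vertex z == ord_max) = false.
  by apply/eqP => /(congr1 val) /= zn; have := ltn_ord z; rewrite zn ltnn.
rewrite /attach !(finset.in_setU, finset.in_set1) !xpair_eqE !old_max andbF /=.
rewrite !orbF; apply/imsetP/idP => [[[a b] /= ab [/val_inj -> /val_inj ->]]//|xy].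
by exists (x, y).
Qed.

Lemma new_in_attach n (t : graph n) k x :
  ((old_vertex x, ord_max) \in attach t k) = (x == k).
Proof.
have old_max z : (old_vertex z == ord_max) = false.
  by apply/eqP => /(congr1 val) /= zn; have := ltn_ord z; rewrite zn ltnn.
rewrite /attach !(finset.in_setU, finset.in_set1) !xpair_eqE !old_max eqxx /=.
rewrite andbT orbF (inj_eq (@old_vertex_inj n)); case: eqP => /=; rewrite ?orbT//.
move=> _; rewrite orbF; apply/imsetP => -[[a b] _ /= [_ nb]].
by have := ltn_ord b; rewrite -nb ltnn.
Qed.

(** The edges between old vertices recover the tree, and the edge at [ord_max] recovers the
    parent. *)
Lemma attach_inj n (t t' : graph n) k k' :
  attach t k = attach t' k' -> t = t' /\ k = k'.
Proof.
move=> tt'; split.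
  by apply/finset.setP => -[x y]; rewrite -(old_in_attach t k) tt' old_in_attach.
by apply/eqP; rewrite -(new_in_attach t') -tt' new_in_attach.
Qed.

Lemma card_lt_leq n K : (#|[set v : 'I_n | (v < K)%N]%SET| <= K)%N.
Proof.
rewrite cardE -[leqRHS](size_iota 0) -(size_map val); apply: uniq_leq_size.
  by rewrite map_inj_uniq ?enum_uniq//; apply: val_inj.
by move=> x /mapP[v]; rewrite mem_enum inE mem_iota => vK ->.
Qed.

(** Inclusion-exclusion inside the labels [< K]: [0.6 K + 0.6 K - K = 0.2 K]. *)
Lemma early_central_meet (R : realType) n (t1 t2 : graph n.+1) (p1 p2 : {perm
  'I_n.+1}) K :
  early_central t1 K -> early_central t2 K ->
  2 / 10 * K%:R
  <= #|(most_central t1 p1 K :&: most_central t2 p2 K)%SET|%:R :> R.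
Proof.
move=> /forallP/(_ p1) + /forallP/(_ p2).
set A := [set v in most_central t1 p1 K | _]%SET.
set B := [set v in most_central t2 p2 K | _]%SET => hA hB.
have AB : (#|A :&: B| <= #|most_central t1 p1 K :&: most_central t2 p2 K|)%N.
  apply: subset_leq_card; apply/fintype.subsetP => v; rewrite !inE.
  by move=> /andP[/andP[-> _] /andP[-> _]].
have ABK : (#|A :|: B| <= K)%N.
  apply: leq_trans (card_lt_leq n.+1 K).
  apply: subset_leq_card; apply/fintype.subsetP => v; rewrite !inE.
  by case/orP => /andP[].
have : (2 * K <= 10 * #|most_central t1 p1 K :&: most_central t2 p2 K|)%N.
  by have := cardsUI A B; lia.
by rewrite -(ler_nat R) !natrM; move: K%:R #|_|%:R => k m; clear; lra.
Qed.

Section Law.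
Variables (R : realType) (d : measure_display) (Omega : measurableType d).
Variable P : probability Omega R.

Lemma measurable_finite (I : finType) (X : Omega -> I) (A : set I) :
  (forall i, measurable [set w | X w = i]) -> measurable [set w | A (X w)].
Proof.
move=> mX; have -> : [set w | A (X w)] = \bigcup_(i in A) [set w | X w = i].
  apply/seteqP; split => [w Aw|w [i Ai /= Xi]]; first by exists (X w).
  by rewrite Xi.
by apply: fin_bigcup_measurable => //; exact: finite_finset.
Qed.

Lemma prob_finite (I : finType) (X : Omega -> I) (A : pred I) :
  (forall i, measurable [set w | X w = i]) ->
  fine (P [set w | A (X w)]) = \sum_(i | A i) fine (P [set w | X w = i]).
Proof.
move=> mX.
have fin B : measurable B -> P B \is a fin_num by move=> ?; exact: fin_num_measure.
suff H (r : seq I) : uniq r ->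
    fine (P [set w | X w \in r]) = \sum_(i <- r) fine (P [set w | X w = i]).
  rewrite -big_filter -H ?filter_uniq ?index_enum_uniq//; congr (fine (P _)).
  by apply/seteqP; split => w /=; rewrite mem_filter mem_index_enum andbT.
elim: r => [_|i r IH /= /andP[ir ur]].
  rewrite big_nil (_ : [set _ | _] = set0) ?measure0//.
  by apply/seteqP; split => w.
rewrite big_cons -IH//.
have mr : measurable [set w | X w \in r].
  exact: (measurable_finite (fun j => j \in r)).
rewrite -fineD ?fin// -measureU//.
  congr (fine (P _)); apply/seteqP; split => w /=; rewrite inE.
    by case/orP => [/eqP|]; [left|right].
  by case=> [->|->]; rewrite ?eqxx ?orbT.
by apply/seteqP; split => w // [/= -> ]; rewrite (negbTE ir).
Qed.

(** A lower bound on the law of [T n] is enough: graphs not of the form [attach t k] are dropped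
    because [f >= 0]. *)
Lemma mean_le_law (T : forall n : nat, Omega -> graph n.+1) n
    (f : graph n.+1 -> R) :
  UA_tree_sequence P T -> (forall t, 0 <= f t) ->
  mean (fun s : code n => f (tree s))
  <= \sum_(t : graph n.+1) fine (P [set w | T n w = t]) * f t.
Proof.
case=> mT T0 TS; elim: n f => [|n IH] f f0.
  rewrite /= (bigD1 finset.set0)//= T0 mul1r lerDl sumr_ge0// => t _.
  by rewrite mulr_ge0// fine_ge0.
have fin B : measurable B -> P B \is a fin_num by move=> ?; exact: fin_num_measure.
pose g (t : graph n.+1) : R := n.+1%:R^-1 * \sum_(k < n.+1) f (attach t k).
rewrite meanS; apply: le_trans (IH g _) _.
  by move=> t; rewrite mulr_ge0 ?invr_ge0// sumr_ge0.
have muS t k : n.+1%:R^-1 * fine (P [set w | T n w = t])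
    <= fine (P [set w | T n.+1 w = attach t k]).
  rewrite -[n.+1%:R^-1]/(fine (n.+1%:R^-1)%:E) -fineM ?fin// -(TS _ _ k).
  have mI : measurable [set w | T n w = t /\ T n.+1 w = attach t k].
    exact: (measurableI _ _ (mT n t) (mT n.+1 _)).
  apply: fine_le; rewrite ?fin//.
  by apply: le_measure; rewrite ?inE// => w [].
pose h (x : graph n.+1 * 'I_n.+1) : graph n.+2 := attach x.1 x.2.
have h_inj : injective h by move=> [t k] [t' k'] /attach_inj[/= -> ->].
pose F (t : graph n.+2) := fine (P [set w | T n.+1 w = t]) * f t.
have F0 t : 0 <= F t by rewrite mulr_ge0// fine_ge0.
(* By injectivity of [h], no graph is counted twice when summing over pairs. *)
apply: (@le_trans _ _ (\sum_(x : graph n.+1 * 'I_n.+1) F (h x))).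
  rewrite -(pair_bigA _ (fun t k => F (attach t k))) /=; apply: ler_sum => t _.
  rewrite /g mulrA mulr_sumr; apply: ler_sum => k _.
  by rewrite /F ler_wpM2r// mulrC.
have -> : \sum_x F (h x) = \sum_(t in (h @: finset.setT)%SET) F t.
  rewrite big_imset/=; first by apply: eq_bigl => x; rewrite finset.in_setT.
  by move=> x y _ _; apply: h_inj.
rewrite [leRHS](bigID (mem (h @: finset.setT)%SET)) /=.
by rewrite lerDl sumr_ge0// => t _; exact: F0.
Qed.

Lemma early_central_prob (T : forall n : nat, Omega -> graph n.+1) K n :
  UA_tree_sequence P T -> (2 <= K)%N -> (400 * K <= n.+1)%N ->
  1 - 700 * 1000 * ln K%:R / K%:R <= fine (P [set w | early_central (T n w) K]).
Proof.
move=> hT K2 Kn; have [b b_bd bE] := mean_balanced R K2 Kn.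
apply: le_trans bE _.
have [mT _ _] := hT.
rewrite (prob_finite (fun t => early_central t K) (mT n)).
have := @mean_le_law T n (fun t => (early_central t K)%:R) hT.
move=> /(_ (fun=> ler0n _ _)) h; apply: le_trans (le_trans h _).
  apply: le_mean => s; rewrite ler_nat; case: (boolP (balanced _ _ _ _)) => // bs.
  rewrite (balanced_early_central b_bd _ bs)//.
  by clear -K2 Kn; lia.
by rewrite [leRHS]big_mkcond; apply: ler_sum => t _; case: ifP; rewrite ?mulr1 ?mulr0.
Qed.

(** A union bound on the complements, valid for any dependence between the two trees. *)
Lemma prob_setI_le (A B E : set Omega) :
  measurable A -> measurable B -> measurable E -> A `&` B `<=` E ->
  fine (P A) + fine (P B) - 1 <= fine (P E).
Proof.
move=> mA mB mE ABE.
have fin D : measurable D -> P D \is a fin_num by move=> ?; exact: fin_num_measure.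
have : (P (~` E) <= P (~` A) + P (~` B))%E.
  apply: (@le_trans _ _ (P (~` A `|` ~` B))).
    apply: le_measure; rewrite ?inE; [exact: measurableC| |].
      by apply: measurableU; exact: measurableC.
    by rewrite -setCI; exact: subsetC.
  exact: (measureU2 P (measurableC mA) (measurableC mB)).
rewrite (probability_setC P mE) (probability_setC P mA) (probability_setC P mB).
rewrite -(fineK (fin _ mE)) -(fineK (fin _ mA)) -(fineK (fin _ mB)).
by rewrite -!EFinB -EFinD lee_fin; lra.
Qed.

End Law.

(** * Combining the two trees under an arbitrary coupling *)

Theorem corollary1p6 (R : realType) (d : measure_display)
    (Omega : measurableType d) (P : probability Omega R)
    (T1 T2 : forall n : nat, Omega -> graph n.+1)
    (s1 s2 : forall n : nat, Omega -> {perm 'I_n.+1})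
    (hT1 : UA_tree_sequence P T1) (hT2 : UA_tree_sequence P T2)
    (hs1 : uniform_tie_breaking P T1 s1) (hs2 : uniform_tie_breaking P T2 s2) :
  exists C : R, forall K : nat, (2 <= K)%N ->
    exists n0 : nat, forall n : nat, (n0 <= n)%N ->
      ((1 - C * ln K%:R / K%:R)%:E <=
       P [set w | (2 / 10 * K%:R <=
            #|(centrality_set T1 s1 K n w :&: centrality_set T2 s2 K n w)%SET|%:R
              :> R)%R])%E.
Proof.
(* Each tree contributes one failure probability of [700 * 1000 * ln K / K]. *)
exists (2 * (700 * 1000)) => K K2; exists (400 * K)%N => n nK.
have arith (x y z a l k : R) : 1 - a * l / k <= x -> 1 - a * l / k <= y ->
  x + y - 1 <= z -> 1 - 2 * a * l / k <= z by clear; lra.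
have h1 := early_central_prob hT1 K2 (leqW nK).
have h2 := early_central_prob hT2 K2 (leqW nK).
have fin B : measurable B -> P B \is a fin_num by move=> ?; exact: fin_num_measure.
have mG T : UA_tree_sequence P T -> measurable [set w | early_central (T n w) K].
  by case=> mT _ _; exact: (measurable_finite (fun t => early_central t K) (mT n)).
set G1 := [set w | early_central (T1 n w) K] in h1.
set G2 := [set w | early_central (T2 n w) K] in h2.
have mG1 : measurable G1 by exact: mG.
have mG2 : measurable G2 by exact: mG.
set E := [set w | _].
have mE : measurable E.
  (* The event depends only on this variable, which takes finitely many values. *)
  pose X w := (T1 n w, T2 n w, s1 n w, s2 n w).
  apply: (measurable_finite (X := X) (fun x => 2 / 10 * K%:R <=
    #|(most_central x.1.1.1 x.1.2 K :&: most_central x.1.1.2 x.2 K)%SET|%:R :> R)).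
  move=> [[[t1 t2] p1] p2].
  have -> : [set w | X w = (t1, t2, p1, p2)] = [set w | T1 n w = t1]
      `&` [set w | T2 n w = t2] `&` [set w | s1 n w = p1] `&` [set w | s2 n w = p2].
    apply/seteqP; split => w; first by rewrite /X /= => -[-> -> -> ->].
    by move=> [[[/= <- <-] <-] <-].
  have [mT1 _ _] := hT1; have [mT2 _ _] := hT2; have [ms1 _] := hs1.
  have [ms2 _] := hs2; by repeat apply: measurableI.
have GE : G1 `&` G2 `<=` E.
  by move=> w [g1 g2]; exact: early_central_meet.
have PE := prob_setI_le P mG1 mG2 mE GE.
rewrite -(fineK (fin _ mE)) lee_fin.
exact: arith h1 h2 PE.
Qed.
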